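(* Let $d\ge2$ and $0<\lambda<1$. There is no constant $c=c(d,\lambda)>0$ such that $$\mathsf{D}(\rho\mid\mu)\ge c\,\mathrm{MMD}^2(\rho,\mu)$$ for every target probability density $\mu\ge\lambda$ almost everywhere on $\mathbb{T}^d$ and every source probability density $\rho$ on $\mathbb{T}^d$.
   Context: $\mathbb{T}^d$ is the flat torus, identified with $(-\frac12,\frac12)^d$ with periodic boundary conditions. $g$ is the periodic Coulomb kernel, $-\Delta g=\delta_0-1$ on $\mathbb{T}^d$. For probability densities $\rho,\mu$, $\mathrm{MMD}^2(\rho,\mu):=\frac12\int_{\mathbb{T}^d}g*(\rho-\mu)\,d(\rho-\mu)=\frac12\int_{\mathbb{T}^d}|\nabla g*(\rho-\mu)|^2\,dx$ and $\mathsf{D}(\rho\mid\mu):=\int_{\mathbb{T}^d}|\nabla g*(\rho-\mu)|^2\,d\rho$. *)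

(* Defs.v *)
From HB Require Import structures.
From mathcomp Require Import all_boot all_order all_algebra.
From mathcomp Require Import all_classical all_reals all_analysis.
Set Implicit Arguments.
Unset Strict Implicit.
Unset Printing Implicit Defensive.
Import Order.TTheory GRing.Theory Num.Theory.
Import numFieldNormedType.Exports.
Local Open Scope classical_set_scope.
Local Open Scope ring_scope.

(* The sigma-algebra on R^n generated by the n coordinates, i.e. the Borel
   one. *)
Section measurable_rV.
Variables (R : realType) (n : nat).

Let coord (i : 'I_n) (x : 'rV[R]_n) : measurableTypeR R := x ord0 i.

Let rV_set0 : g_sigma_preimage coord set0.
Proof. exact: sigma_algebra0. Qed.

Let rV_setC A : g_sigma_preimage coord A -> g_sigma_preimage coord (~` A).
Proof. exact: sigma_algebraC. Qed.

Let rV_bigcup (F : _^nat) : (forall i, g_sigma_preimage coord (F i)) ->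
  g_sigma_preimage coord (\bigcup_i (F i)).
Proof. exact: sigma_algebra_bigcup. Qed.

HB.instance Definition _ := @isMeasurable.Build default_measure_display
  'rV[R]_n (g_sigma_preimage coord) rV_set0 rV_setC rV_bigcup.

End measurable_rV.

Section coordinates.
Variable R : realType.

Lemma measurable_coord n (i : 'I_n) :
  measurable_fun [set: 'rV[R]_n] (fun x => x ord0 i : measurableTypeR R).
Proof.
move=> _ Y mY; rewrite setTI; apply: sub_sigma_algebra => /=.
rewrite -bigcup_seq/=; exists i => /=; first by rewrite mem_index_enum.
by exists Y => //; rewrite setTI.
Qed.

Lemma measurable_fun_rV d (T : measurableType d) n (f : T -> 'rV[R]_n) :
  (forall i, measurable_fun [set: T] (fun t => f t ord0 i : measurableTypeR R)) ->
  measurable_fun [set: T] f.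
Proof.
move=> mf _ A mA; rewrite setTI.
suff : @measurable _ 'rV[R]_n `<=` [set B | measurable (f @^-1` B)] by exact.
apply: smallest_sub.
  split=> /=; first by rewrite preimage_set0; exact: measurable0.
    by move=> B mB; rewrite setTD preimage_setC; exact: measurableC.
  by move=> F mF; rewrite preimage_bigcup; exact: bigcup_measurable.
rewrite -bigcup_seq/=; apply: bigcup_sub => i _ _ [B mB <-] /=.
rewrite setTI -comp_preimage -[X in measurable X]setTI.
exact: mf.
Qed.

Definition cons_rV n (p : measurableTypeR R * 'rV[R]_n) : 'rV[R]_n.+1 :=
  \row_i oapp (fun j => p.2 ord0 j) p.1 (unlift ord0 i).

Lemma measurable_cons_rV n : measurable_fun setT (@cons_rV n).
Proof.
apply: measurable_fun_rV => i; rewrite /cons_rV.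
under eq_fun do rewrite mxE.
case: unliftP => [j _|_] /=; last exact: measurable_fst.
by apply: (measurableT_comp (measurable_coord j)); exact: measurable_snd.
Qed.

HB.instance Definition _ n :=
  @isMeasurableFun.Build _ _ _ _ (@cons_rV n) (@measurable_cons_rV n).

Lemma half_ltr : - 2^-1 < 2^-1 :> R.
Proof. by rewrite (@lt_trans _ _ 0) ?oppr_lt0 ?invr_gt0. Qed.

End coordinates.

Section torus.
Variable R : realType.

(* Lebesgue measure on the cube [-1/2,1/2]^n, as a Borel measure on R^n: the
   n-fold product of the uniform probability on [-1/2,1/2]. *)
Fixpoint torus_measure n : probability 'rV[R]_n R :=
  if n is m.+1 then
    distribution (uniform_prob (half_ltr R) \x torus_measure m)%E
      (@cons_rV R m)
  else dirac (0 : 'rV[R]_0).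

Variable d : nat.
Implicit Types (f g phi rho mu : 'rV[R]_d -> R) (G : 'I_d -> 'rV[R]_d -> R).

(* Functions on the torus R^d/Z^d are Z^d-periodic functions on R^d; their
   integrals over the torus are integrals against torus_measure d. *)
Definition unit_vec (i : 'I_d) : 'rV[R]_d := delta_mx ord0 i.

Definition periodic f := forall i x, f (x + unit_vec i) = f x.

Definition partial (i : 'I_d) f : 'rV[R]_d -> R := 'D_(unit_vec i) f.

Definition iter_partial (s : seq 'I_d) f := foldr partial f s.

Definition smooth f := forall s : seq 'I_d,
  continuous (iter_partial s f) /\
  forall i x, derivable (iter_partial s f) x (unit_vec i).

Definition test_function phi := periodic phi /\ smooth phi.

Definition laplacian f x := \sum_(i < d) partial i (partial i f) x.

Definition torus_L1 f :=
  periodic f /\ (torus_measure d).-integrable setT (EFin \o f).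

(* - Delta g = delta_0 - 1 in the sense of distributions on the torus; this
   determines g up to an additive constant and almost everywhere. *)
Definition coulomb_kernel g := torus_L1 g /\
  forall phi, test_function phi ->
    - (\int[torus_measure d]_x (g x * laplacian phi x)) =
    phi 0 - \int[torus_measure d]_x phi x.

(* G is the distributional gradient of g. *)
Definition weak_gradient g G := forall i, torus_L1 (G i) /\
  forall phi, test_function phi ->
    (\int[torus_measure d]_x (G i x * phi x)) =
    - \int[torus_measure d]_x (g x * partial i phi x).

(* For f and h in L^1 of the torus the integral converges for almost every x;
   at the other points the value is irrelevant. *)
Definition conv f h (x : 'rV[R]_d) : R :=
  \int[torus_measure d]_y (f (x - y) * h y).

Definition prob_density rho :=
  [/\ periodic rho, measurable_fun setT rho, (forall x, 0 <= rho x) &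
      (\int[torus_measure d]_x (rho x)%:E)%E = 1%E].

(* The integrand has no sign when rho and mu are unbounded: a positive and a
   negative part both of infinite integral give -oo, so an undefined MMD never
   violates a lower bound D >= c MMD^2. *)
Definition MMD2 g rho mu : \bar R :=
  ((2^-1)%:E * \int[torus_measure d]_x
     (conv g (rho \- mu) x * (rho x - mu x))%:E)%E.

(* D(rho | mu), with G the gradient of the kernel. *)
Definition dissipation G rho mu : \bar R :=
  (\int[torus_measure d]_x
     ((\sum_(i < d) conv (G i) (rho \- mu) x ^+ 2) * rho x)%:E)%E.

End torus.

(* Main.v *)
From HB Require Import structures.
Require Import Defs.
From mathcomp Require Import all_boot all_order all_algebra.
From mathcomp Require Import all_classical all_reals all_analysis.
From mathcomp Require Import measurable_realfun ring lra.
Import Order.TTheory GRing.Theory Num.Theory.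
Import numFieldNormedType.Exports.
Local Open Scope classical_set_scope.
Local Open Scope ring_scope.

(** The dissipation sees the field only where the source has mass, whereas the MMD
    sees it everywhere. So let the target concentrate at a place which the source
    avoids: from dimension 2 on, the self-energy of a concentrating charge is
    unbounded, while its field stays bounded away from the charge, hence on the
    support of the source. The ratio of dissipation to MMD then tends to 0.

    The construction starts from the potential. For a smooth periodic [phi] and two
    densities with [rho - mu = - laplacian phi], the defining equations of the kernel
    and of its gradient give [g * (rho - mu) = phi] up to a constant
    ([conv_coulomb]) and [G * (rho - mu) = grad phi] ([conv_coulomb_gradient]).
    The kernel enters only through these two equations; they are tested against the
    reflected translates of [phi], which rests on the invariance of the torus measure
    under [y |-> x - y] ([integral_torus_reflect]).
    Then MMD^2 is [1/2] times the integral of [|grad phi|^2] ([MMD2_laplacian]), and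
    the dissipation is at most the supremum of [|grad phi|^2] over the set where
    [rho] does not vanish ([dissipation_laplacian_le]).

    The potential is [(2 pi)^-2 * (A ln (s + eps) + B s)], where
    [s = (1 - cos (2 pi x_0)) + (1 - cos (2 pi x_1))] is comparable to the squared
    distance to the set [x_0 = x_1 = 0]. Two coordinates are enough, and with only
    two of them the logarithm has infinite energy in the limit, whatever the
    dimension. For suitable [A] and [B], independent of [eps]:
    - on the core [s <= r] the Laplacian is at least [lambda], so the source may be
      taken equal to 0 there and the target equal to the Laplacian
      ([le_laplacian_core], [densities_of_laplacian]);
    - the mass of [max (laplacian phi) lambda] is at most 1 ([Rintegral_max_le]);
    - outside the core [|grad phi|] is bounded uniformly in [eps].
    The energy is at least a multiple of the integral of [1 / (s + eps)]
    ([sq_gradient_potential_ge]), which grows by a fixed amount whenever [eps] is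
    halved ([Rintegral_rwell_double]).

    None of these integrals is computed. The estimates all come from the fact that a
    partial derivative integrates to 0 ([Rintegral_partial]): applied to the gradient
    of [ln (s + eps)] it bounds the mass of the approximate Dirac mass
    [eps / (s + eps)^2] from both sides ([Rintegral_rwell2_le],
    [Rintegral_rwell2_ge]), and it turns the energy of the logarithm into the
    integral of [1 / (s + eps)]. *)

Set Implicit Arguments.
Unset Strict Implicit.
Unset Printing Implicit Defensive.

(** * Invariance of the torus measure under reflections *)

Definition reflection (R : realType) (a : R) (s : measurableTypeR R) :
  measurableTypeR R := a - s.

Lemma measurable_reflect (R : realType) (a : R) :
  measurable_fun [set: measurableTypeR R] (reflection a).
Proof. exact: measurable_funB. Qed.

HB.instance Definition _ (R : realType) (a : R) :=
  isMeasurableFun.Build _ _ _ _ (reflection a) (measurable_reflect a).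

Lemma pushforward_lebesgue_reflect (R : realType) (a : R) (A : set R) :
  measurable A ->
  pushforward (@lebesgue_measure R) (reflection a) A = lebesgue_measure A.
Proof.
move=> mA; apply/esym/lebesgue_measure_unique => //= _ [[b c]] _ <-.
rewrite /pushforward /=.
rewrite (_ : _ @^-1` _ = `[a - c, a - b[%classic); last first.
  by apply/seteqP; split=> s /=; rewrite /reflection !in_itv /= => /andP[? ?]; lra.
rewrite !lebesgue_measure_itv/= !lte_fin ltrD2l ltrN2.
by case: ifP => // _; rewrite -!EFinB; congr EFin; ring.
Qed.

Lemma integral_reflect_itv (R : realType) (a b c : R) (f : R -> \bar R) :
  measurable_fun setT f -> (forall x, 0 <= f x)%E ->
  (\int[lebesgue_measure]_(s in `[b, c]) f (a - s)%R =
   \int[lebesgue_measure]_(s in `[(a - c)%R, (a - b)%R]) f s)%E.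
Proof.
move=> mf f0.
rewrite (_ : `[b, c]%classic = reflection a @^-1` `[a - c, a - b]%classic);
  last first.
  by apply/seteqP; split=> s /=; rewrite /reflection !in_itv /= => /andP[? ?]; lra.
rewrite -(ge0_integral_pushforward (measurable_reflect a)) //=;
  last exact: measurable_funTS.
by apply: eq_measure_integral => //= A mA _; exact: pushforward_lebesgue_reflect.
Qed.

Lemma periodic_shift (R : realType) (T : Type) (f : R -> T) :
  (forall s, f (s + 1) = f s) -> forall (k : int) s, f (s + k%:~R) = f s.
Proof.
move=> fp.
have fpn n s : f (s + n%:R) = f s.
  elim: n s => [|n ih] s; first by rewrite addr0.
  by rewrite -natr1 addrA fp ih.
by case=> n s; rewrite ?NegzE ?mulrNz -pmulrn ?fpn// -[LHS](fpn n.+1) subrK.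
Qed.

(** Reflection turns the fundamental cell into another window of length 1; the part
    that sticks out of the cell is moved back into it by a period. *)
Lemma integral_reflect_periodic (R : realType) (a : R) (f : R -> \bar R) :
  measurable_fun setT f -> (forall x, 0 <= f x)%E ->
  (forall s, f (s + 1) = f s) ->
  (\int[lebesgue_measure]_(s in `[(- 2^-1)%R, 2^-1%R]) f (a - s)%R =
   \int[lebesgue_measure]_(s in `[(- 2^-1)%R, 2^-1%R]) f s)%E.
Proof.
move=> mf f0 fp.
(* By periodicity the centre of reflection may be taken in [0, 1). *)
pose b := a - (Num.floor a)%:~R.
have b01 : 0 <= b < 1.
  rewrite /b subr_ge0 floor_le/= ltrBlDl.
  by have := floorD1_gt a; rewrite intrD.
under eq_integral.
  move=> s _.
  rewrite -[(a - s)%R](_ : (b - s) + (Num.floor a)%:~R = _)%R; last first.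
    by rewrite /b; ring.
  rewrite (periodic_shift fp).
  over.
rewrite integral_reflect_itv//.
have split (x y z : R) : x <= y <= z ->
   (\int[lebesgue_measure]_(s in `[x, z]) f s =
    \int[lebesgue_measure]_(s in `[x, y]) f s +
    \int[lebesgue_measure]_(s in `[y, z]) f s)%E.
  move=> /andP[xy yz].
  rewrite (@itv_bndbnd_setU _ _ (BLeft x) (BRight y) (BRight z)) ?bnd_simp//.
  rewrite ge0_integral_setU//=.
  - by rewrite integral_itv_obnd_cbnd//; exact: measurable_funTS.
  - exact: measurable_funTS.
  - by apply/disj_setPS => s [] /=; rewrite !in_itv/= => /andP[_ sy] /andP[]; lra.
rewrite (split _ 2^-1 _); last by lra.
rewrite [RHS](split _ (b - 2^-1) _); last by lra.
rewrite addeC; congr (_ + _)%E.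
(* The translation by a period is the composite of two reflections, of centres
   [b] and [b - 1]. *)
have window (c : R) :
    (\int[lebesgue_measure]_(s in `[(- 2^-1)%R, (b - 2^-1)%R]) f (c - s)%R =
     \int[lebesgue_measure]_(s in `[(c - b + 2^-1)%R, (c + 2^-1)%R]) f s)%E.
  rewrite integral_reflect_itv// (_ : c - (b - 2^-1) = c - b + 2^-1) ?opprK//.
  by ring.
have := window b; have := window (b - 1).
rewrite (_ : b - 1 - b + 2^-1 = - 2^-1); last by field.
rewrite (_ : b - 1 + 2^-1 = b - 2^-1); last by field.
rewrite subrr add0r opprK => <- <-.
by apply: eq_integral => s _; rewrite -(fp (b - 1 - s)); congr f; ring.
Qed.

Lemma cons_rV0 (R : realType) n (s : R) (z : 'rV[R]_n) k :
  cons_rV (s, z) k ord0 = s.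
Proof. by rewrite mxE unlift_none. Qed.

Lemma cons_rV_lift (R : realType) n (s : R) (z : 'rV[R]_n) k i :
  cons_rV (s, z) k (lift ord0 i) = z ord0 i.
Proof. by rewrite mxE liftK. Qed.

Lemma cons_rV_eta (R : realType) n (x : 'rV[R]_n.+1) :
  x = cons_rV (x ord0 ord0, \row_(i < n) x ord0 (lift ord0 i)).
Proof.
apply/rowP => i; case: (unliftP ord0 i) => [j ->|->].
  by rewrite mxE liftK /= mxE.
by rewrite mxE unlift_none.
Qed.

Lemma cons_rVD (R : realType) n (s t : R) (y z : 'rV[R]_n) :
  cons_rV (s + t, y + z) = cons_rV (s, y) + cons_rV (t, z).
Proof.
by apply/rowP => i; rewrite !mxE; case: unliftP => [j _|_] //=; rewrite mxE.
Qed.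

Lemma cons_rVN (R : realType) n (s : R) (y : 'rV[R]_n) :
  cons_rV (- s, - y) = - cons_rV (s, y).
Proof.
by apply/rowP => i; rewrite !mxE; case: unliftP => [j _|_] //=; rewrite mxE.
Qed.

Lemma unit_vec0 (R : realType) n : unit_vec R (@ord0 n) = cons_rV (1, 0).
Proof.
apply/rowP => i; rewrite mxE eqxx /=; case: (unliftP ord0 i) => [j ->|->].
  by rewrite cons_rV_lift mxE.
by rewrite cons_rV0 eqxx.
Qed.

Lemma unit_vec_lift (R : realType) n (j : 'I_n) :
  unit_vec R (lift ord0 j) = cons_rV (0, unit_vec R j).
Proof.
apply/rowP => i; rewrite !mxE; case: unliftP => [k ->|->] //=.
by rewrite mxE (inj_eq lift_inj).
Qed.

Lemma measurable_reflect_rV (R : realType) n (x : 'rV[R]_n) :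
  measurable_fun [set: 'rV[R]_n] (fun y => x - y).
Proof.
apply: measurable_fun_rV => i.
under eq_fun do rewrite mxE [X in _ + X]mxE.
by apply: measurable_funB => //; exact: measurable_coord.
Qed.

Lemma integral_torusS (R : realType) n (F : 'rV[R]_n.+1 -> \bar R) :
  measurable_fun setT F -> (forall x, 0 <= F x)%E ->
  (\int[torus_measure R n.+1]_x F x =
   \int[lebesgue_measure]_(s in `[(- 2^-1)%R, 2^-1%R])
     \int[torus_measure R n]_z F (cons_rV (s, z)))%E.
Proof.
move=> mF F0.
have mFc : measurable_fun setT (F \o @cons_rV R n).
  by apply: measurableT_comp => //; exact: measurable_cons_rV.
rewrite /= ge0_integral_distribution//.
rewrite fubini_tonelli1//=.
rewrite integral_uniform.
- by rewrite opprK [2^-1 + 2^-1](_ : _ = 1) ?invr1 ?mul1e//; field.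
- by apply: measurable_fun_fubini_tonelli_F => //= p; exact: F0.
- by move=> s; rewrite /fubini_F; apply: integral_ge0 => z _; exact: F0.
Qed.

(** The torus is a compact abelian group and [torus_measure] is its Haar measure. One
    coordinate is peeled off at a time; periodicity is essential, since the measure is
    carried by a single fundamental cell. *)
Lemma integral_torus_reflect (R : realType) n (F : 'rV[R]_n -> \bar R)
    (x : 'rV[R]_n) :
  measurable_fun setT F -> (forall y, 0 <= F y)%E ->
  (forall i y, F (y + unit_vec R i) = F y) ->
  (\int[torus_measure R n]_y F (x - y)%R = \int[torus_measure R n]_y F y)%E.
Proof.
elim: n F x => [|n ih] F x mF F0 Fp.
  by apply: eq_integral => y _; congr F; apply/rowP; case.
have mFx : measurable_fun setT (fun y : 'rV[R]_n.+1 => F (x - y)).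
  exact: (measurableT_comp mF (measurable_reflect_rV x)).
rewrite (integral_torusS mFx (fun y => F0 (x - y))) (integral_torusS mF F0).
have mFc : measurable_fun setT (F \o @cons_rV R n).
  by apply: measurableT_comp => //; exact: measurable_cons_rV.
under eq_integral.
  move=> s _.
  under eq_integral.
    move=> z _.
    rewrite [in (x - _)%R](cons_rV_eta x) -cons_rVN -cons_rVD.
    over.
  rewrite (ih (fun z => F (cons_rV (x ord0 ord0 - s, z)))) //; last 2 first.
  - by apply: (measurableT_comp mFc); exact: pair1_measurable.
  - move=> i y; rewrite -[in RHS](Fp (lift ord0 i)) unit_vec_lift -cons_rVD.
    by rewrite addr0.
  over.
apply: (@integral_reflect_periodic R (x ord0 ord0)
  (fun s => \int[torus_measure R n]_z F (cons_rV (s, z)))%E).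
- apply: (@measurable_fun_fubini_tonelli_F _ _ _ _ _ (torus_measure R n)
    (F \o @cons_rV R n)) => // p; exact: F0.
- by move=> s; apply: integral_ge0.
- move=> s; apply: eq_integral => z _.
  by rewrite -[in RHS](Fp ord0) unit_vec0 -cons_rVD addr0.
Qed.

(** * Derivatives along a direction *)

Section derive_along.
Variables (R : realType) (V : normedModType R).
Implicit Types (f : V -> R) (F : R -> R).

(** A directional derivative is the derivative of a function of one real variable,
    which gives access to the chain rule on the line. *)
Lemma is_derive_line f (x v : V) (t df : R) :
  is_derive (t *: v + x) v f df <->
  is_derive t 1 (fun h : R => f (h *: v + x)) df.
Proof.
set k := fun h : R => f (h *: v + x).
have e : (fun h : R => h^-1 *: ((f \o shift (t *: v + x)) (h *: v)
             - f (t *: v + x))) =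
         (fun h : R => h^-1 *: ((k \o shift t) (h *: (1 : R)) - k t)).
  by apply/funext => h; rewrite /= /k addrA -scalerDl [h *: 1]mulr1.
have de : derivable f (t *: v + x) v <-> derivable k t 1 by rewrite /derivable e.
have De : 'D_v f (t *: v + x) = 'D_1 k t by rewrite /derive e.
split=> -[dfx dfv]; apply: DeriveDef.
- exact: de.1 dfx.
- by rewrite -De.
- exact: de.2 dfx.
- by rewrite De.
Qed.

Lemma is_derive_at f (x v : V) (df : R) :
  is_derive x v f df <-> is_derive (0 : R) 1 (fun h : R => f (h *: v + x)) df.
Proof. by rewrite -is_derive_line scale0r add0r. Qed.

Lemma is_derive_comp_along F f (x v : V) (dF df : R) :
  is_derive x v f df -> is_derive (f x) 1 F dF ->
  is_derive x v (F \o f) (dF * df).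
Proof.
move=> /is_derive_at dfx dFx; apply/is_derive_at.
apply: (@is_derive1_comp _ F (fun h : R => f (h *: v + x)) 0) => //.
by rewrite scale0r add0r.
Qed.

End derive_along.

(** * Elementary functions on the torus *)

Section elementary.
Variables (R : realType) (d : nat).
Implicit Types (f g : 'rV[R]_d -> R) (x : 'rV[R]_d) (i j : 'I_d).

Definition angle i x : R := 2 * pi * x ord0 i.

(** Smooth periodic functions are built here as elementary expressions in the
    characters of the torus: a class that is visibly closed under partial derivatives
    and all of whose members are visibly periodic, bounded, continuous and Borel, so
    that no compactness argument is needed. *)
Inductive elementary : ('rV[R]_d -> R) -> Prop :=
| elementary_cst c : elementary (fun _ => c)
| elementary_cos i : elementary (fun x => cos (angle i x))
| elementary_sin i : elementary (fun x => sin (angle i x))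
| elementaryD f g : elementary f -> elementary g ->
    elementary (fun x => f x + g x)
| elementaryM f g : elementary f -> elementary g ->
    elementary (fun x => f x * g x)
| elementaryV f c : 0 < c -> (forall x, c <= f x) -> elementary f ->
    elementary (fun x => (f x)^-1)
| elementary_ln f c : 0 < c -> (forall x, c <= f x) -> elementary f ->
    elementary (fun x => ln (f x)).

Lemma elementaryN f : elementary f -> elementary (fun x => - f x).
Proof.
move=> ef; rewrite (_ : (fun _ => _) = (fun x => -1 * f x)).
  by apply: elementaryM => //; exact: elementary_cst.
by apply/funext => x; rewrite mulN1r.
Qed.

Lemma elementary_sum (I : Type) (r : seq I) (P : pred I)
    (F : I -> 'rV[R]_d -> R) :
  (forall k, P k -> elementary (F k)) ->
  elementary (fun x => \sum_(k <- r | P k) F k x).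
Proof.
move=> eF; elim: r => [|k r ih].
  by under eq_fun do rewrite big_nil; exact: elementary_cst.
under eq_fun do rewrite big_cons.
case: (boolP (P k)) => // Pk.
by apply: elementaryD => //; exact: eF.
Qed.

Lemma elementary_periodic f : elementary f -> Defs.periodic f.
Proof.
have ap i j x : angle j (x + unit_vec R i) = angle j x + (pi *+ 2) *+ (j == i).
  by rewrite /angle !mxE eqxx/= mulrDr mulr2n; case: (j == i); rewrite /=; ring.
elim=> //.
- by move=> j i x; rewrite ap; case: (j == i); rewrite ?addr0// cosD2pi.
- by move=> j i x; rewrite ap; case: (j == i); rewrite ?addr0// sinD2pi.
- by move=> {}f g _ fp _ gp i x; rewrite fp gp.
- by move=> {}f g _ fp _ gp i x; rewrite fp gp.
- by move=> {}f c _ _ _ fp i x; rewrite fp.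
- by move=> {}f c _ _ _ fp i x; rewrite fp.
Qed.

Lemma measurable_angle j :
  measurable_fun setT (fun x => angle j x : measurableTypeR R).
Proof. by apply: measurable_funM => //; exact: measurable_coord. Qed.

Lemma elementary_measurable f : elementary f -> measurable_fun setT f.
Proof.
elim=> //.
- move=> j; apply: (measurableT_comp _ (measurable_angle j)).
  by apply: continuous_measurable_fun; exact: continuous_cos.
- move=> j; apply: (measurableT_comp _ (measurable_angle j)).
  by apply: continuous_measurable_fun; exact: continuous_sin.
- by move=> {}f g _ fp _ gp; exact: measurable_funD.
- by move=> {}f g _ fp _ gp; exact: measurable_funM.
- move=> {}f c c0 cf _ mf.
  rewrite (_ : (fun _ => _) = (fun x => expR (- ln (f x)))).
    apply: measurableT_comp; first exact: measurable_expR.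
    by apply: measurable_funN; exact: (measurableT_comp (@measurable_ln R)).
  by apply/funext => x; rewrite expRN lnK// posrE (lt_le_trans c0).
- by move=> {}f c _ _ _ mf; exact: (measurableT_comp (@measurable_ln R)).
Qed.

Lemma elementary_bounded f :
  elementary f -> exists C : R, forall x, `|f x| <= C.
Proof.
elim=> //.
- by move=> c; exists `|c|.
- by move=> j; exists 1 => x; rewrite ler_norml cos_geN1 cos_le1.
- by move=> j; exists 1 => x; rewrite ler_norml sin_geN1 sin_le1.
- move=> {}f g _ [C fC] _ [D gD]; exists (C + D) => x.
  by rewrite (le_trans (ler_normD _ _))// lerD.
- move=> {}f g _ [C fC] _ [D gD]; exists (C * D) => x.
  by rewrite normrM ler_pM.
- move=> {}f c c0 cf _ _; exists c^-1 => x.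
  have f0 := lt_le_trans c0 (cf x).
  by rewrite gtr0_norm ?invr_gt0// lef_pV2 ?posrE.
- move=> {}f c c0 cf _ [C fC]; exists (`|ln c| + `|ln C|) => x.
  have f0 := lt_le_trans c0 (cf x).
  have fxC : f x <= C := le_trans (ler_norm _) (fC x).
  have C0 := lt_le_trans f0 fxC.
  have h1 : ln c <= ln (f x) by rewrite ler_ln ?posrE.
  have h2 : ln (f x) <= ln C by rewrite ler_ln ?posrE.
  rewrite ler_norml; apply/andP; split.
    have := ler_norm (- ln c); rewrite normrN; have := normr_ge0 (ln C); lra.
  have := ler_norm (ln C); have := normr_ge0 (ln c); lra.
Qed.

Lemma elementary_continuous f : elementary f -> continuous f.
Proof.
have ca j : continuous (angle j).
  by move=> x; apply: continuous_comp;
    [exact: coord_continuous|exact: mulrl_continuous].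
elim=> //.
- by move=> c; exact: cst_continuous.
- by move=> j x; apply: continuous_comp; [exact: ca|exact: continuous_cos].
- by move=> j x; apply: continuous_comp; [exact: ca|exact: continuous_sin].
- by move=> {}f g _ cf _ cg x; apply: continuousD; [exact: cf|exact: cg].
- by move=> {}f g _ cf _ cg x; apply: continuousM; [exact: cf|exact: cg].
- move=> {}f c c0 cf _ kf x; apply: continuousV; last exact: kf.
  by rewrite gt_eqF// (lt_le_trans c0).
- move=> {}f c c0 cf _ kf x; apply: continuous_comp; first exact: kf.
  by apply: continuous_ln; rewrite (lt_le_trans c0).
Qed.

Lemma is_derive_coord i j x :
  is_derive x (unit_vec R i) (fun y : 'rV[R]_d => y ord0 j) ((j == i)%:R : R).
Proof.
apply/is_derive_at.
rewrite (_ : (fun _ => _) = (fun h : R => h * (j == i)%:R + x ord0 j)); last first.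
  by apply/funext => h; rewrite !mxE eqxx.
apply: is_derive_eq.
by rewrite addr0 scaler0 add0r [_ *: _]mulr1.
Qed.

Lemma partialE i f f' :
  (forall x, is_derive x (unit_vec R i) f (f' x)) -> partial i f = f'.
Proof. by move=> ff'; apply/funext => x; exact: derive_val. Qed.

Lemma is_derive_angle i j x :
  is_derive x (unit_vec R i) (angle j) (2 * pi * (j == i)%:R).
Proof.
rewrite (_ : angle j = (2 * pi) \*: (fun y : 'rV[R]_d => y ord0 j)).
  by apply: is_deriveZ; exact: is_derive_coord.
by apply/funext.
Qed.

Lemma is_derive_cos_angle i j x :
  is_derive x (unit_vec R i) (fun y => cos (angle j y))
    (- (2 * pi * (j == i)%:R) * sin (angle j x)).
Proof.
rewrite mulNr -mulrN mulrC.
by apply: is_derive_comp_along; exact: is_derive_angle.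
Qed.

Lemma is_derive_sin_angle i j x :
  is_derive x (unit_vec R i) (fun y => sin (angle j y))
    (2 * pi * (j == i)%:R * cos (angle j x)).
Proof.
by rewrite mulrC; apply: is_derive_comp_along; exact: is_derive_angle.
Qed.

Lemma is_derive_inv_along f v x df : 0 < f x -> is_derive x v f df ->
  is_derive x v (fun y => (f y)^-1) (- ((f x)^-1 ^+ 2) * df).
Proof.
move=> f0 dfx.
apply: (is_derive_comp_along (F := fun t => t^-1)) => //.
rewrite -[X in is_derive _ _ _ X]mulr1 exprVn.
by apply: (@is_deriveV R id (f x) 1 1); rewrite gt_eqF.
Qed.

Lemma is_derive_ln_along f v x df : 0 < f x -> is_derive x v f df ->
  is_derive x v (fun y => ln (f y)) ((f x)^-1 * df).
Proof.
by move=> f0 dfx; apply: is_derive_comp_along => //; exact: is_derive1_ln.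
Qed.

Lemma elementary_derive f : elementary f -> forall i,
  exists2 f', elementary f' & forall x, is_derive x (unit_vec R i) f (f' x).
Proof.
elim=> [c|j|j|{}f g _ fd _ gd|{}f g ef fd eg gd|{}f c c0 cf ef fd|
        {}f c c0 cf ef fd] i.
- exists (fun=> 0); first exact: elementary_cst.
  by move=> x; exact: is_derive_cst.
- exists (fun x => - (2 * pi * (j == i)%:R) * sin (angle j x)).
    by apply: elementaryM; [exact: elementary_cst|exact: elementary_sin].
  exact: is_derive_cos_angle.
- exists (fun x => 2 * pi * (j == i)%:R * cos (angle j x)).
    by apply: elementaryM; [exact: elementary_cst|exact: elementary_cos].
  exact: is_derive_sin_angle.
- have [f' ef' ff'] := fd i; have [g' eg' gg'] := gd i.
  exists (fun x => f' x + g' x); first exact: elementaryD.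
  by move=> x; exact: is_deriveD.
- have [f' ef' ff'] := fd i; have [g' eg' gg'] := gd i.
  exists (fun x => f x * g' x + g x * f' x).
    by apply: elementaryD; exact: elementaryM.
  by move=> x; exact: is_deriveM.
- have [f' ef' ff'] := fd i.
  have eV := elementaryV c0 cf ef.
  exists (fun x => - ((f x)^-1 ^+ 2) * f' x).
    by apply: elementaryM => //; apply: elementaryN; exact: (elementaryM eV eV).
  by move=> x; apply: is_derive_inv_along => //; exact: lt_le_trans (cf x).
- have [f' ef' ff'] := fd i.
  exists (fun x => (f x)^-1 * f' x).
    by apply: elementaryM => //; exact: elementaryV c0 cf ef.
  by move=> x; apply: is_derive_ln_along => //; exact: lt_le_trans (cf x).
Qed.

Lemma elementary_partial i f : elementary f -> elementary (partial i f).
Proof.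
by move=> ef; have [f' ef' /partialE ->] := elementary_derive ef i.
Qed.

Lemma elementary_is_derive i f x : elementary f ->
  is_derive x (unit_vec R i) f (partial i f x).
Proof.
move=> ef; have [f' ef' ff'] := elementary_derive ef i.
by rewrite (partialE ff').
Qed.

Lemma elementary_laplacian f : elementary f -> elementary (laplacian f).
Proof.
move=> ef; apply: elementary_sum => i _; exact/elementary_partial/elementary_partial.
Qed.

Lemma elementary_test_function f : elementary f -> test_function f.
Proof.
move=> ef; split; first exact: elementary_periodic.
move=> s; have es : elementary (iter_partial s f).
  by elim: s => //= i s; exact: elementary_partial.
split; first exact: elementary_continuous.
by move=> i x; have [] := elementary_is_derive i x es.
Qed.

End elementary.

(** * Reflected test functions *)

Section reflection.
Variables (R : realType) (d : nat).
Implicit Types (f g : 'rV[R]_d -> R) (x v : 'rV[R]_d).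

Lemma is_derive_reflect f x v y df : is_derive (x - y) v f df ->
  is_derive y v (fun z => f (x - z)) (- df).
Proof.
move=> fd; apply/is_derive_at.
rewrite (_ : (fun _ => _) =
    (fun h : R => f (h *: v + (x - y))) \o (fun h : R => - h)); last first.
  by apply/funext => h /=; rewrite scaleNr; congr f; rewrite opprD addrCA.
rewrite -mulrN1.
have fd0 : is_derive (- 0 : R) 1 (fun h : R => f (h *: v + (x - y))) df.
  by rewrite oppr0; exact: (is_derive_at f (x - y) v df).1 fd.
exact: is_derive1_comp fd0 (is_deriveNid _ _).
Qed.

Lemma smooth_reflect f x : smooth f -> smooth (fun y => f (x - y)).
Proof.
move=> sf.
have e s : iter_partial s (fun y => f (x - y)) =
           (fun y => (-1) ^+ size s * iter_partial s f (x - y)).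
  elim: s => [|i s ih] /=; first by apply/funext => y; rewrite mul1r.
  rewrite ih; apply/partialE => y.
  rewrite exprS mulN1r mulNr -mulrN.
  apply: is_deriveZ; apply: is_derive_reflect.
  by apply: derivableP; exact: (sf s).2.
move=> s; rewrite e; split.
  have cx : continuous (fun y : 'rV[R]_d => x - y).
    by move=> y; apply: continuousB; [exact: cst_continuous|exact: id].
  have cf : continuous (fun y : 'rV[R]_d => iter_partial s f (x - y)).
    by move=> y; exact: (continuous_comp (cx y) ((sf s).1 (x - y))).
  by move=> y; exact: (continuous_comp (cf y) (@mulrl_continuous _ _ _)).
move=> i y; apply: (@derivableZ _ _ _ (fun y : 'rV[R]_d => iter_partial s f (x - y))).
by have [] := is_derive_reflect (derivableP ((sf s).2 i (x - y))).
Qed.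

Lemma test_function_reflect f x :
  test_function f -> test_function (fun y => f (x - y)).
Proof.
move=> [fp sf]; split; last exact: smooth_reflect.
by move=> i y; rewrite -(fp i (x - (y + _))) opprD addrA subrK.
Qed.

Lemma partial_reflect f x i : test_function f ->
  partial i (fun y => f (x - y)) = (fun y => - partial i f (x - y)).
Proof.
move=> [_ sf]; apply/partialE => y.
by apply: is_derive_reflect; apply: derivableP; exact: (sf [::]).2.
Qed.

Lemma test_function_partial f i : test_function f -> test_function (partial i f).
Proof.
move=> [fp sf]; split.
  move=> j x; have /is_derive_at fd := derivableP ((sf [::]).2 i x).
  suff fdj : is_derive (x + unit_vec R j) (unit_vec R i) f (partial i f x).
    exact: derive_val.
  apply/is_derive_at; rewrite (_ : (fun _ => _) =
    (fun h : R => f (h *: unit_vec R i + x)))//.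
  by apply/funext => h; rewrite addrA fp.
by move=> s; have := sf (rcons s i); rewrite /iter_partial foldr_rcons.
Qed.

Lemma laplacian_reflect f x : test_function f ->
  laplacian (fun y => f (x - y)) = (fun y => laplacian f (x - y)).
Proof.
move=> tf; apply/funext => y; apply: eq_bigr => i _.
rewrite (partial_reflect x i tf).
rewrite (_ : partial i _ = fun y => partial i (partial i f) (x - y))//.
apply/partialE => z; rewrite -[X in is_derive _ _ _ X]opprK.
apply: is_deriveN; apply: is_derive_reflect; apply: derivableP.
exact: ((test_function_partial i tf).2 [::]).2.
Qed.

End reflection.

(** * Convolution with the Coulomb kernel *)

Section convolution.
Variables (R : realType) (d : nat).
Implicit Types (f g h : 'rV[R]_d -> R) (x : 'rV[R]_d).
Local Notation T := (torus_measure R d).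

Definition unif_bounded f := exists C : R, forall x, `|f x| <= C.

Lemma measurable_fun_reflect f x : measurable_fun setT f ->
  measurable_fun setT (fun y : 'rV[R]_d => f (x - y)).
Proof. by move=> mf; exact: (measurableT_comp mf (measurable_reflect_rV x)). Qed.

Lemma Rintegral_torus_reflect f x : Defs.periodic f -> measurable_fun setT f ->
  \int[T]_y f (x - y) = \int[T]_y f y.
Proof.
move=> fp mf.
have mEf : measurable_fun setT (EFin \o f) by exact/measurable_EFinP.
have p i y : (EFin \o f) (y + unit_vec R i) = (EFin \o f) y by rewrite /= fp.
rewrite /Rintegral [in LHS]integralE [in RHS]integralE; congr (fine (_ - _)).
- rewrite -(@integral_torus_reflect _ _ (EFin \o f)^\+%E x)//.
  + by apply: eq_integral => y _; rewrite !funeposE.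
  + exact: measurable_funepos.
  + by move=> i y; rewrite !funeposE p.
- rewrite -(@integral_torus_reflect _ _ (EFin \o f)^\-%E x)//.
  + by apply: eq_integral => y _; rewrite !funenegE.
  + exact: measurable_funeneg.
  + by move=> i y; rewrite !funenegE p.
Qed.

(** The definition of [conv] puts the translation on the first factor; here it falls on
    the second, the one which will be a test function. *)
Lemma convE f h x : Defs.periodic f -> Defs.periodic h ->
  measurable_fun setT f -> measurable_fun setT h ->
  Defs.conv f h x = \int[T]_y (f y * h (x - y)).
Proof.
move=> fp hp mf mh.
rewrite -(@Rintegral_torus_reflect (fun y => f y * h (x - y)) x).
- by apply: eq_Rintegral => y _; rewrite subKr.
- by move=> i y; rewrite fp -(hp i (x - (y + _))) opprD addrA subrK.
- by apply: measurable_funM => //; exact: measurable_fun_reflect.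
Qed.

Lemma integrableM_bounded f h : T.-integrable setT (EFin \o f) ->
  measurable_fun setT h -> unif_bounded h ->
  T.-integrable setT (EFin \o (fun y => f y * h y)).
Proof.
move=> fi mh [C hC].
apply: (@integrableMl _ _ _ T setT measurableT (EFin \o f) h) => //.
exists C; split; first exact: num_real.
by move=> M CM y _; exact: le_trans (hC y) (ltW CM).
Qed.

Lemma integrable_bounded h : measurable_fun setT h -> unif_bounded h ->
  T.-integrable setT (EFin \o h).
Proof.
move=> mh [C hC]; apply: measurable_bounded_integrable => //.
  by rewrite (le_lt_trans (probability_le1 _ _))// ltry.
exists C; split; first exact: num_real.
by move=> M CM y _; exact: le_trans (hC y) (ltW CM).
Qed.

Lemma RintegralN f : T.-integrable setT (EFin \o f) ->
  \int[T]_y (- f y) = - \int[T]_y f y.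
Proof.
move=> fi; rewrite -mulN1r -RintegralZl//.
by apply: eq_Rintegral => y _; rewrite mulN1r.
Qed.

(** Differentiating under the integral, the derivative of a convolution falls on its
    regular factor. *)
Lemma is_derive_conv f h h' i x : torus_L1 f ->
  Defs.periodic h -> measurable_fun setT h -> unif_bounded h ->
  (forall y, is_derive y (unit_vec R i) h (h' y)) ->
  Defs.periodic h' -> measurable_fun setT h' -> unif_bounded h' ->
  is_derive x (unit_vec R i) (Defs.conv f h) (Defs.conv f h' x).
Proof.
move=> [fp fi] hp mh [C hC] hd h'p mh' [C' h'C'].
have mf : measurable_fun setT f by exact/measurable_EFinP/measurable_int/fi.
have mhx (k : 'rV[R]_d -> R) z D : measurable_fun setT k ->
    (forall y, `|k y| <= D) ->
    T.-integrable setT (EFin \o (fun y => f y * k (z - y))).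
  move=> mk kD; apply: integrableM_bounded => //.
    exact: measurable_fun_reflect.
  by exists D => y.
pose F (t : R) (y : 'rV[R]_d) := f y * h (t *: unit_vec R i + x - y).
have Fd (t : R) (y : 'rV[R]_d) :
    is_derive t 1 (F ^~ y) (f y * h' (t *: unit_vec R i + x - y)).
  have := (is_derive_line h (x - y) (unit_vec R i) t _).1 (hd _).
  rewrite !addrA => hl; have := is_deriveZ (f y) hl.
  by congr is_derive; apply/funext => u; rewrite /F -addrA.
have Fi t : `]-1, 1[%classic t -> T.-integrable setT (EFin \o F t).
  by move=> _; exact: mhx hC.
have Fd1 (t : R) (y : 'rV[R]_d) : `]-1, 1[%classic t -> [set: 'rV[R]_d] y ->
    derivable (F ^~ y) t 1.
  by move=> _ _; have [] := Fd t y.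
have C'0 : 0 <= C' by exact: le_trans (normr_ge0 _) (h'C' 0).
pose D (y : 'rV[R]_d) := `|f y| * C'.
have D0 y : 0 <= D y by rewrite mulr_ge0.
have Di : T.-integrable setT (EFin \o D).
  rewrite /comp /D; under eq_fun do rewrite EFinM.
  by apply: integrableZr => //; exact: integrable_norm.
have FD (t : R) (y : 'rV[R]_d) : `]-1, 1[%classic t -> [set: 'rV[R]_d] y ->
    `|partial1of2 F t y| <= D y.
  move=> _ _; rewrite partial1of2E (@derive_val _ _ _ _ _ _ _ (Fd t y)).
  by rewrite normrM /D ler_wpM2l.
have I0 : `]-1, 1[%classic (0 : R) by rewrite /= in_itv/= ltrN10 ltr01.
have der := derivable_under_integral measurableT I0 Fi Fd1 D0 Di FD.
have val := differentiation_under_integral measurableT I0 Fi Fd1 D0 Di FD.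
apply/is_derive_at.
rewrite (_ : (fun _ => _) = (fun t : R => \int[T]_y F t y)); last first.
  by apply/funext => t; rewrite convE.
apply: DeriveDef; first exact: der.
rewrite -derive1E val convE//; apply: eq_Rintegral => y _.
by rewrite partial1of2E (@derive_val _ _ _ _ _ _ _ (Fd 0 y)) scale0r add0r.
Qed.

Lemma conv_elementaryE f h x : torus_L1 f -> elementary h ->
  Defs.conv f h x = \int[T]_y (f y * h (x - y)).
Proof.
move=> [fp fi] eh; apply: convE => //.
- exact: elementary_periodic.
- exact/measurable_EFinP/measurable_int/fi.
- exact: elementary_measurable.
Qed.

Lemma is_derive_conv_elementary f h i x : torus_L1 f -> elementary h ->
  is_derive x (unit_vec R i) (Defs.conv f h) (Defs.conv f (partial i h) x).
Proof.
move=> fL1 eh; have eh' := elementary_partial i eh.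
apply: is_derive_conv => //; do ?[exact: elementary_periodic|
  exact: elementary_measurable|exact: elementary_bounded].
by move=> y; exact: elementary_is_derive.
Qed.

(** The convolution of [h] with the constant 1 is constant, so its derivative, which is
    the convolution of 1 with the derivative of [h], vanishes. *)
Lemma Rintegral_partial i h : elementary h -> \int[T]_y partial i h y = 0.
Proof.
move=> eh.
have eh' := elementary_partial i eh.
pose one : 'rV[R]_d -> R := fun=> 1.
have one_L1 : torus_L1 one.
  split; first by move=> j x.
  apply: integrable_bounded; first exact: measurable_cst.
  by exists 1 => x; rewrite normr1.
have conv1 k : elementary k -> Defs.conv one k = (fun=> \int[T]_y k y).
  move=> ek; apply/funext => x; rewrite conv_elementaryE//.
  under eq_Rintegral do rewrite mul1r.
  rewrite Rintegral_torus_reflect//.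
    exact: elementary_periodic.
  exact: elementary_measurable.
have := is_derive_conv_elementary i 0 one_L1 eh.
rewrite !conv1// => hd; rewrite -(@derive_val _ _ _ _ _ _ _ hd).
exact: derive_cst.
Qed.

(** The equation of [g] is tested against the reflected translates of [f]. *)
Lemma conv_coulomb g f x : coulomb_kernel g -> elementary f ->
  Defs.conv g (fun y => - laplacian f y) x = f x - \int[T]_y f y.
Proof.
move=> [gL1 gP] ef; have [gp gi] := gL1.
have eN := elementaryN (elementary_laplacian ef).
have tf := elementary_test_function ef.
rewrite conv_elementaryE//.
have := gP _ (test_function_reflect x tf).
rewrite subr0 (laplacian_reflect x tf) Rintegral_torus_reflect//; last 2 first.
- exact: elementary_periodic.
- exact: elementary_measurable.
move=> <-; rewrite -RintegralN.
  by apply: eq_Rintegral => y _; rewrite mulrN.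
apply: integrableM_bounded => //.
  by apply: measurable_fun_reflect; apply: elementary_measurable;
    exact: elementary_laplacian.
have [C fC] := elementary_bounded (elementary_laplacian ef).
by exists C => y.
Qed.

(** The weak gradient moves the derivative from the kernel to the Laplacian of [f].
    What appears is the derivative in [x] of the left-hand side of [conv_coulomb]. *)
Lemma conv_coulomb_gradient g (G : 'I_d -> 'rV[R]_d -> R) f i x :
  coulomb_kernel g -> weak_gradient g G -> elementary f ->
  Defs.conv (G i) (fun y => - laplacian f y) x = partial i f x.
Proof.
move=> gC gG ef.
have [gL1 _] := gC; have [gp gi] := gL1; have [GL1 GP] := gG i.
have eN := elementaryN (elementary_laplacian ef).
have eN' := elementary_partial i eN.
rewrite conv_elementaryE//.
rewrite (GP _ (test_function_reflect x (elementary_test_function eN))).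
rewrite (partial_reflect x i (elementary_test_function eN)).
rewrite -RintegralN; last first.
  apply: integrableM_bounded => //.
    by apply: measurable_funN; apply: measurable_fun_reflect;
      exact: elementary_measurable.
  have [C fC] := elementary_bounded eN'.
  by exists C => y; rewrite normrN.
under eq_Rintegral do rewrite mulrN opprK.
rewrite -conv_elementaryE//.
have := is_derive_conv_elementary i x gL1 eN.
move=> hd; rewrite -(@derive_val _ _ _ _ _ _ _ hd).
rewrite (_ : Defs.conv g _ = (fun y => f y + - \int[T]_z f z)); last first.
  by apply/funext => y; exact: conv_coulomb.
have fd := elementary_is_derive i x ef.
by rewrite -[RHS]addr0; apply: derive_val.
Qed.

End convolution.

(** * Energy and dissipation of a given potential *)

Section energy.
Variables (R : realType) (d : nat).
Implicit Types (f g phi rho mu w : 'rV[R]_d -> R) (x : 'rV[R]_d).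
Local Notation T := (torus_measure R d).

Lemma elementary_integrable f :
  elementary f -> T.-integrable setT (EFin \o f).
Proof.
move=> ef; apply: integrable_bounded.
  exact: elementary_measurable.
exact: elementary_bounded.
Qed.

Lemma Rintegral_elementaryD f g : elementary f -> elementary g ->
  \int[T]_y (f y + g y) = \int[T]_y f y + \int[T]_y g y.
Proof. by move=> ef eg; rewrite RintegralD//; exact: elementary_integrable. Qed.

Lemma Rintegral_elementaryB f g : elementary f -> elementary g ->
  \int[T]_y (f y - g y) = \int[T]_y f y - \int[T]_y g y.
Proof. by move=> ef eg; rewrite RintegralB//; exact: elementary_integrable. Qed.

Lemma Rintegral_elementaryZ c f : elementary f ->
  \int[T]_y (c * f y) = c * \int[T]_y f y.
Proof. by move=> ef; rewrite RintegralZl//; exact: elementary_integrable. Qed.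

Lemma Rintegral_torus_cst c : \int[T]_y c = c.
Proof.
rewrite Rintegral_cst// -[RHS]mulr1; congr (_ * _).
by rewrite -[RHS]/(fine 1%E); congr fine; exact: probability_setT.
Qed.

Lemma le_Rintegral_elementary f g : elementary f -> elementary g ->
  (forall x, f x <= g x) -> \int[T]_y f y <= \int[T]_y g y.
Proof.
by move=> ef eg fg; apply: le_Rintegral => //; exact: elementary_integrable.
Qed.

Lemma Rintegral_elementary_sum (F : 'I_d -> 'rV[R]_d -> R) :
  (forall i, elementary (F i)) ->
  \int[T]_y (\sum_(i < d) F i y) = \sum_(i < d) \int[T]_y F i y.
Proof.
move=> eF; elim: (index_enum _) => [|i r ih].
  under eq_Rintegral do rewrite big_nil.
  by rewrite Rintegral_torus_cst big_nil.
under eq_Rintegral do rewrite big_cons.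
rewrite big_cons -ih Rintegral_elementaryD//.
by apply: elementary_sum => k _.
Qed.

Lemma Rintegral_laplacian phi :
  elementary phi -> \int[T]_y laplacian phi y = 0.
Proof.
move=> ephi; rewrite Rintegral_elementary_sum => [|i].
  by rewrite big1// => i _; rewrite Rintegral_partial//; exact: elementary_partial.
exact/elementary_partial/elementary_partial.
Qed.

Definition sq_gradient phi x := \sum_(i < d) partial i phi x ^+ 2.

Lemma elementary_sq_gradient phi : elementary phi -> elementary (sq_gradient phi).
Proof.
by move=> ephi; apply: elementary_sum => i _; apply: elementaryM;
  exact: elementary_partial.
Qed.

(** Integration by parts: the partial derivatives of [phi * partial i phi] integrate
    to 0. *)
Lemma Green phi : elementary phi ->
  \int[T]_y (phi y * - laplacian phi y) = \int[T]_y sq_gradient phi y.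
Proof.
move=> ephi.
have ep i := elementary_partial i ephi.
have epp i := elementary_partial i (ep i).
have eL := elementary_laplacian ephi.
have eq := elementary_sq_gradient ephi.
apply/eqP; rewrite -subr_eq0 -Rintegral_elementaryB//; last first.
  by apply: elementaryM => //; exact: elementaryN.
rewrite (_ : (fun _ => _) = (fun y => - \sum_(i < d)
    partial i (fun z => phi z * partial i phi z) y)); last first.
  apply/funext => y; rewrite /laplacian /sq_gradient mulrN -opprD; congr -%R.
  rewrite mulr_sumr -big_split/=; apply: eq_bigr => i _.
  rewrite (_ : partial i (fun z => phi z * partial i phi z) =
    fun z => phi z * partial i (partial i phi) z +
             partial i phi z * partial i phi z) ?expr2//.
  by apply/partialE => z; apply: is_deriveM; exact: elementary_is_derive.
have eM i : elementary (partial i (fun z => phi z * partial i phi z)).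
  by apply: elementary_partial; exact: elementaryM.
rewrite RintegralN; last first.
  by apply: elementary_integrable; apply: elementary_sum => i _.
rewrite Rintegral_elementary_sum// big1 ?oppr0// => i _.
by rewrite Rintegral_partial//; exact: elementaryM.
Qed.

Lemma EFin_Rintegral f : T.-integrable setT (EFin \o f) ->
  (\int[T]_y (f y)%:E)%E = (\int[T]_y f y)%:E.
Proof. by move=> fi; rewrite fineK//; exact: integrable_fin_num. Qed.

(** The potential of the pair is [phi] up to a constant, which does not contribute
    because a Laplacian has integral 0. *)
Lemma MMD2_laplacian g phi rho mu : coulomb_kernel g -> elementary phi ->
  (forall x, rho x - mu x = - laplacian phi x) ->
  MMD2 g rho mu = (2^-1 * \int[T]_y sq_gradient phi y)%:E.
Proof.
move=> gC ephi rm.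
have eL := elementaryN (elementary_laplacian ephi).
have ePL := elementaryM ephi eL.
rewrite /MMD2 (_ : rho \- mu = fun y => - laplacian phi y); last exact/funext.
pose m := \int[T]_y phi y.
under eq_integral do rewrite conv_coulomb// rm mulrBl.
rewrite EFin_Rintegral; last first.
  rewrite -[fun x => _]/(fun x => phi x * - laplacian phi x - m * - laplacian phi x).
  apply: elementary_integrable; apply: elementaryD => //; apply: elementaryN.
  by apply: elementaryM => //; exact: elementary_cst.
rewrite -EFinM; congr (2^-1 * _)%:E.
rewrite Rintegral_elementaryB//; last first.
  by apply: elementaryM => //; exact: elementary_cst.
rewrite Rintegral_elementaryZ// RintegralN; last first.
  exact/elementary_integrable/elementary_laplacian.
by rewrite Rintegral_laplacian// oppr0 mulr0 subr0 Green.
Qed.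

(** The field of the pair is the gradient of [phi] at every point, and it is averaged
    against the probability [rho]. *)
Lemma dissipation_laplacian_le g (G : 'I_d -> 'rV[R]_d -> R) phi rho mu C :
  coulomb_kernel g -> weak_gradient g G -> elementary phi ->
  (forall x, rho x - mu x = - laplacian phi x) -> prob_density rho ->
  (forall x, rho x != 0 -> sq_gradient phi x <= C) ->
  (dissipation G rho mu <= C%:E)%E.
Proof.
move=> gC gG ephi rm [rhop mrho rho0 rho1] gradC.
rewrite /dissipation (_ : rho \- mu = fun y => - laplacian phi y); last exact/funext.
under eq_integral.
  move=> x _.
  rewrite (eq_bigr (fun i => partial i phi x ^+ 2)); last first.
    by move=> i _; rewrite (conv_coulomb_gradient i x gC gG ephi).
  over.
have C0 : 0 <= C.
  have [[x rhox]|/forallNP rho00] := pselect (exists x, rho x != 0).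
    by apply: le_trans (gradC x rhox); apply: sumr_ge0 => i _; exact: sqr_ge0.
  move: rho1; rewrite integral0_eq => [[]/esym/eqP|x _]; first by rewrite oner_eq0.
  by have /negP := rho00 x; rewrite negbK => /eqP ->.
rewrite -[leRHS]mule1 -rho1 -ge0_integralZl//=; last 2 first.
- exact/measurable_EFinP.
- by move=> x _; rewrite lee_fin.
apply: ge0_le_integral => //.
- move=> x _; rewrite lee_fin mulr_ge0//.
  by apply: sumr_ge0 => i _; exact: sqr_ge0.
- apply/measurable_EFinP/measurable_funM => //.
  exact: (elementary_measurable (elementary_sq_gradient ephi)).
- exact/measurable_EFinP/measurable_funM.
- move=> x _; rewrite -EFinM lee_fin.
  by have [->|/gradC] := eqVneq (rho x) 0; [rewrite !mulr0|exact: ler_wpM2r].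
Qed.

(** The least function which is above [lambda] and leaves a nonnegative source is
    [max (laplacian phi) lambda]. It is completed to a probability density by a
    multiple of [w], and the source is what the equation then imposes. *)
Lemma densities_of_laplacian phi w (lambda : R) : elementary phi ->
  Defs.periodic w -> measurable_fun setT w -> unif_bounded w ->
  (forall x, 0 <= w x) -> 0 < \int[T]_y w y -> 0 <= lambda ->
  \int[T]_y Num.max (laplacian phi y) lambda <= 1 ->
  exists mu rho, [/\ prob_density mu, forall x, lambda <= mu x, prob_density rho,
    forall x, rho x - mu x = - laplacian phi x &
    forall x, lambda <= laplacian phi x -> w x = 0 -> rho x = 0].
Proof.
move=> ephi wp mw bw w0 intw lambda0 intmax.
have eL := elementary_laplacian ephi.
pose M y := Num.max (laplacian phi y) lambda.
pose c := (1 - \int[T]_y M y) / \int[T]_y w y.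
have c0 : 0 <= c by rewrite divr_ge0 ?subr_ge0// ltW.
have mM : measurable_fun setT M.
  apply: (@measurable_maxr _ _ _ _ (laplacian phi) (cst lambda)) => //.
  exact: elementary_measurable.
have Mlambda y : lambda <= M y by rewrite /M le_max lexx orbT.
have ML y : laplacian phi y <= M y by rewrite /M le_max lexx.
have iM : T.-integrable setT (EFin \o M).
  apply: integrable_bounded => //.
  have [C LC] := elementary_bounded eL; exists (C + lambda) => y.
  rewrite ger0_norm ?(le_trans lambda0)// /M ge_max.
  have := LC y; rewrite ler_norml => /andP[_ LyC].
  have := le_trans (normr_ge0 _) (LC y).
  by move=> C0; apply/andP; split; lra.
have iw : T.-integrable setT (EFin \o w).
  exact: integrable_bounded.
have icw : T.-integrable setT (EFin \o (fun y => c * w y)).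
  by rewrite /comp; under eq_fun do rewrite EFinM; exact: integrableZl.
pose mu y := M y + c * w y.
pose rho y := mu y - laplacian phi y.
have imu : T.-integrable setT (EFin \o mu).
  by rewrite /comp; under eq_fun do rewrite EFinD; exact: integrableD.
have irho : T.-integrable setT (EFin \o rho).
  rewrite /comp; under eq_fun do rewrite EFinB.
  by apply: integrableB => //; exact: elementary_integrable.
have int_mu : \int[T]_y mu y = 1.
  rewrite RintegralD// RintegralZl// /c divfK ?gt_eqF//.
  by rewrite addrC subrK.
have int_rho : \int[T]_y rho y = 1.
  rewrite RintegralB//; last exact: elementary_integrable.
  by rewrite int_mu Rintegral_laplacian// subr0.
have Lp := elementary_periodic eL.
have mup : Defs.periodic mu by move=> i y; rewrite /mu /M Lp wp.
have mu_ge y : M y <= mu y by rewrite /mu lerDl mulr_ge0.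
exists mu, rho; split.
- split => //.
  + exact/measurable_EFinP/measurable_int/imu.
  + by move=> y; rewrite (le_trans lambda0)// (le_trans (Mlambda y)).
  + by rewrite EFin_Rintegral// int_mu.
- by move=> y; exact: le_trans (mu_ge y).
- split.
  + by move=> i y; rewrite /rho mup Lp.
  + exact/measurable_EFinP/measurable_int/irho.
  + by move=> y; rewrite /rho subr_ge0 (le_trans (ML y)).
  + by rewrite EFin_Rintegral// int_rho.
- by move=> y; rewrite /rho addrAC subrr add0r.
- move=> y lambdaL wy; rewrite /rho /mu /M wy mulr0 addr0.
  by rewrite max_l// subrr.
Qed.

End energy.

(** * The logarithmic potential *)

Section log_potential.
Variables (R : realType) (d : nat) (i0 i1 : 'I_d).
Hypothesis i01 : i0 != i1.
Implicit Types (x : 'rV[R]_d) (A B eps : R).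
Local Notation T := (torus_measure R d).

(** A smooth periodic function comparable to the squared distance to the set where the
    coordinates [i0] and [i1] are both integers. *)
Definition well x : R := (1 - cos (angle i0 x)) + (1 - cos (angle i1 x)).

(** The squared gradient of [well], divided by [(2 pi)^2]. *)
Definition slope2 x : R := sin (angle i0 x) ^+ 2 + sin (angle i1 x) ^+ 2.

Definition wellD i x : R :=
  2 * pi * ((i0 == i)%:R * sin (angle i0 x) + (i1 == i)%:R * sin (angle i1 x)).

Definition wellDD i x : R :=
  (2 * pi) ^+ 2 *
  ((i0 == i)%:R * cos (angle i0 x) + (i1 == i)%:R * cos (angle i1 x)).

Definition bumps x : R := (1 - cos (angle i0 x)) * (1 - cos (angle i1 x)).

Lemma is_derive_well i x : is_derive x (unit_vec R i) well (wellD i x).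
Proof.
have h j : is_derive x (unit_vec R i) (fun y : 'rV[R]_d => 1 - cos (angle j y))
    (2 * pi * (j == i)%:R * sin (angle j x)).
  have := is_deriveB (is_derive_cst (1 : R) x (unit_vec R i))
    (is_derive_cos_angle i j x).
  by rewrite mulNr opprK add0r.
apply: (is_derive_eq (is_deriveD (h i0) (h i1))).
by rewrite /wellD; ring.
Qed.

Lemma is_derive_wellD i x : is_derive x (unit_vec R i) (wellD i) (wellDD i x).
Proof.
pose k j : R := 2 * pi * (j == i)%:R.
have h j : is_derive x (unit_vec R i)
    (fun y : 'rV[R]_d => k j * sin (angle j y))
    (k j * (2 * pi * (j == i)%:R * cos (angle j x))).
  exact: is_deriveZ (is_derive_sin_angle i j x).
rewrite (_ : wellD i = (fun y : 'rV[R]_d => k i0 * sin (angle i0 y)) +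
    (fun y : 'rV[R]_d => k i1 * sin (angle i1 y))).
  apply: (is_derive_eq (is_deriveD (h i0) (h i1))).
  by rewrite /wellDD /k; case: (i0 == i); case: (i1 == i) => /=; ring.
by apply/funext => y; rewrite /wellD /k fctE; ring.
Qed.

Lemma sum_coord (F0 F1 : R) :
  \sum_(i < d) ((i0 == i)%:R * F0 + (i1 == i)%:R * F1) = F0 + F1.
Proof.
rewrite big_split/=; congr (_ + _).
  by rewrite (bigD1 i0)//= eqxx mul1r big1 ?addr0// => i;
    rewrite eq_sym => /negbTE ->; rewrite mul0r.
by rewrite (bigD1 i1)//= eqxx mul1r big1 ?addr0// => i;
  rewrite eq_sym => /negbTE ->; rewrite mul0r.
Qed.

Lemma sum_wellDD x : \sum_(i < d) wellDD i x = (2 * pi) ^+ 2 * (2 - well x).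
Proof. by rewrite -mulr_sumr sum_coord /well; congr (_ * _); ring. Qed.

Lemma sum_wellD_sq x : \sum_(i < d) wellD i x ^+ 2 = (2 * pi) ^+ 2 * slope2 x.
Proof.
rewrite /slope2 -sum_coord mulr_sumr; apply: eq_bigr => i _; rewrite /wellD.
move: i01; have [->|_] := eqVneq i0 i; last by case: (i1 == i) => _ /=; ring.
by rewrite eq_sym => /negbTE -> /=; ring.
Qed.

Lemma well_ge0 x : 0 <= well x.
Proof. by rewrite addr_ge0// subr_ge0 cos_le1. Qed.

Lemma well_le4 x : well x <= 4.
Proof.
rewrite /well; have := cos_geN1 (angle i0 x); have := cos_geN1 (angle i1 x); lra.
Qed.

Lemma slope2_ge0 x : 0 <= slope2 x.
Proof. by rewrite addr_ge0// sqr_ge0. Qed.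

Lemma slope2_le2 x : slope2 x <= 2.
Proof.
rewrite /slope2; have := cos2Dsin2 (angle i0 x); have := cos2Dsin2 (angle i1 x).
have := sqr_ge0 (cos (angle i0 x)); have := sqr_ge0 (cos (angle i1 x)); lra.
Qed.

Lemma bumps_ge0 x : 0 <= bumps x.
Proof. by rewrite mulr_ge0// subr_ge0 cos_le1. Qed.

Lemma bumps_le x : bumps x <= well x ^+ 2 / 4.
Proof.
rewrite /bumps /well.
have := sqr_ge0 (cos (angle i0 x) - cos (angle i1 x)); nra.
Qed.

Lemma slope2E x : slope2 x = 2 * well x - well x ^+ 2 + 2 * bumps x.
Proof.
rewrite /slope2 /well /bumps.
have := cos2Dsin2 (angle i0 x); have := cos2Dsin2 (angle i1 x); lra.
Qed.

Lemma elementary_1Bcos j :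
  elementary (fun x : 'rV[R]_d => 1 - cos (angle j x)).
Proof.
apply: elementaryD; first exact: elementary_cst.
exact/elementaryN/elementary_cos.
Qed.

Lemma elementary_well : elementary well.
Proof. by apply: elementaryD; exact: elementary_1Bcos. Qed.

Lemma elementary_bumps : elementary bumps.
Proof. by apply: elementaryM; exact: elementary_1Bcos. Qed.

Lemma elementary_slope2 : elementary slope2.
Proof. by apply: elementaryD; apply: elementaryM; exact: elementary_sin. Qed.

Section regularised.
Variable eps : R.
Hypothesis eps_gt0 : 0 < eps.

Definition rwell x : R := (well x + eps)^-1.

Let well_eps x : eps <= well x + eps.
Proof. by rewrite lerDr well_ge0. Qed.

Lemma welleps_gt0 x : 0 < well x + eps.
Proof. exact: lt_le_trans (well_eps x). Qed.

Lemma rwell_gt0 x : 0 < rwell x.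
Proof. by rewrite invr_gt0 welleps_gt0. Qed.

Lemma rwellK x : rwell x * (well x + eps) = 1.
Proof. by rewrite mulVf// gt_eqF// welleps_gt0. Qed.

Let elementary_welleps : elementary (fun x => well x + eps).
Proof. exact: elementaryD elementary_well (elementary_cst _ _). Qed.

Lemma elementary_rwell : elementary rwell.
Proof. exact: elementaryV eps_gt0 well_eps elementary_welleps. Qed.

Lemma elementary_rwell2 : elementary (fun x => rwell x ^+ 2).
Proof. exact: elementaryM elementary_rwell elementary_rwell. Qed.

(** The factor [(2 pi)^-2] removes the powers of [2 pi] brought by differentiating the
    angles twice. *)
Definition potential A B x : R :=
  (2 * pi) ^- 2 * (A * ln (well x + eps) + B * well x).

Lemma elementary_potential A B : elementary (potential A B).
Proof.
apply: elementaryM; first exact: elementary_cst.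
apply: elementaryD; apply: elementaryM; do ?exact: elementary_cst.
  exact: elementary_ln eps_gt0 well_eps elementary_welleps.
exact: elementary_well.
Qed.

Let is_derive_welleps i x :
  is_derive x (unit_vec R i) (fun y => well y + eps) (wellD i x).
Proof.
apply: (is_derive_eq (is_deriveD (is_derive_well i x) (is_derive_cst eps _ _))).
by rewrite addr0.
Qed.

Let is_derive_rwell i x :
  is_derive x (unit_vec R i) rwell (- (rwell x ^+ 2) * wellD i x).
Proof. exact: is_derive_inv_along (welleps_gt0 x) (is_derive_welleps i x). Qed.

Lemma partial_potential A B i : partial i (potential A B) =
  (fun x => (2 * pi) ^- 2 * ((A * rwell x + B) * wellD i x)).
Proof.
apply/partialE => x; apply: is_deriveZ.
apply: (is_derive_eq (is_deriveD (is_deriveZ A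
  (is_derive_ln_along (welleps_gt0 x) (is_derive_welleps i x)))
  (is_deriveZ B (is_derive_well i x)))).
by rewrite mulrDl -mulrA.
Qed.

Lemma partial2_potential A B i x : partial i (partial i (potential A B)) x =
  (2 * pi) ^- 2 * ((A * rwell x + B) * wellDD i x
                   - A * rwell x ^+ 2 * wellD i x ^+ 2).
Proof.
rewrite partial_potential.
have hA : is_derive x (unit_vec R i) (fun y => A * rwell y + B)
    (A * (- (rwell x ^+ 2) * wellD i x)).
  apply: (is_derive_eq (is_deriveD (is_deriveZ A (is_derive_rwell i x))
    (is_derive_cst B _ _))).
  by rewrite addr0.
have hM : is_derive x (unit_vec R i)
    (fun y => (2 * pi) ^- 2 * ((A * rwell y + B) * wellD i y))
    ((2 * pi) ^- 2 * ((A * rwell x + B) * wellDD i x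
                      + wellD i x * (A * (- (rwell x ^+ 2) * wellD i x)))).
  exact: is_deriveZ (is_deriveM hA (is_derive_wellD i x)).
rewrite [LHS](@derive_val _ _ _ _ _ _ _ hM).
by congr (_ * _); ring.
Qed.

Let pi_neq0 : pi != 0 :> R.
Proof. by rewrite gt_eqF ?pi_gt0. Qed.

Lemma laplacian_potential A B x : laplacian (potential A B) x =
  A * ((2 - well x) * rwell x - slope2 x * rwell x ^+ 2) + B * (2 - well x).
Proof.
rewrite /laplacian; under eq_bigr do rewrite partial2_potential.
rewrite -mulr_sumr big_split/= sumrN -[X in X - _]mulr_sumr.
rewrite -[X in _ - X]mulr_sumr sum_wellDD sum_wellD_sq.
by move: pi pi_neq0 => t t0; field.
Qed.

Lemma sq_gradient_potential A B x : sq_gradient (potential A B) x =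
  (2 * pi) ^- 2 * ((A * rwell x + B) ^+ 2 * slope2 x).
Proof.
rewrite /sq_gradient.
under eq_bigr do rewrite partial_potential exprMn [(_ * wellD _ _) ^+ 2]exprMn.
rewrite -mulr_sumr -[X in _ * X]mulr_sumr sum_wellD_sq.
by move: pi pi_neq0 => t t0; field.
Qed.

(** In the plane, the Laplacian of the regularised logarithm is an approximate Dirac
    mass, here the term [2 * eps]. The torus adds the two other terms, which stay
    bounded after multiplication by [rwell x ^+ 2], uniformly in [eps]. *)
Lemma laplacian_lnE x : (2 - well x) * rwell x - slope2 x * rwell x ^+ 2 =
  (2 * eps - eps * well x - 2 * bumps x) * rwell x ^+ 2.
Proof.
rewrite slope2E; have e := rwellK x.
have -> : (2 - well x) * rwell x =
  (2 - well x) * (rwell x * (rwell x * (well x + eps))).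
  by rewrite e mulr1.
by ring.
Qed.

Lemma Rintegral_well : \int[T]_y well y = 2.
Proof.
have := Rintegral_laplacian (elementary_potential 0 1).
under eq_Rintegral do rewrite laplacian_potential mul0r add0r mul1r.
rewrite Rintegral_elementaryB; [|exact: elementary_cst|exact: elementary_well].
by rewrite Rintegral_torus_cst => /eqP; rewrite subr_eq0 => /eqP.
Qed.

(** [bumps] differs from [well - 1] by a product of cosines, which is a derivative. *)
Lemma Rintegral_bumps : \int[T]_y bumps y = 1.
Proof.
pose k (x : 'rV[R]_d) := sin (angle i0 x) * cos (angle i1 x).
have ek : elementary k.
  by apply: elementaryM; [exact: elementary_sin|exact: elementary_cos].
have kd : partial i0 k =
    (fun x => 2 * pi * (cos (angle i0 x) * cos (angle i1 x))).
  apply/partialE => x.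
  apply: (is_derive_eq (is_deriveM (is_derive_sin_angle i0 i0 x)
    (is_derive_cos_angle i0 i1 x))).
  rewrite eqxx [i1 == i0]eq_sym (negbTE i01).
  rewrite -[LHS]/(sin (angle i0 x) * (- (2 * pi * 0) * sin (angle i1 x)) +
    cos (angle i1 x) * (2 * pi * 1 * cos (angle i0 x))).
  by ring.
have ec : elementary (fun x : 'rV[R]_d => cos (angle i0 x) * cos (angle i1 x)).
  by apply: elementaryM; exact: elementary_cos.
have := Rintegral_partial i0 ek; rewrite kd Rintegral_elementaryZ// => /eqP.
rewrite !mulf_eq0 pnatr_eq0/= (negbTE pi_neq0)/= => /eqP k0.
rewrite (_ : bumps = fun x => well x + - 1 + cos (angle i0 x) * cos (angle i1 x)).
  have e1 : @elementary R d (fun=> - 1) := elementary_cst _ _.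
  rewrite (Rintegral_elementaryD (elementaryD elementary_well e1) ec).
  rewrite (Rintegral_elementaryD elementary_well e1).
  by rewrite k0 Rintegral_torus_cst Rintegral_well; ring.
by apply/funext => x; rewrite /bumps /well; ring.
Qed.

(** The two sides differ by the integral of a Laplacian. *)
Lemma Rintegral_rwell2_eq : \int[T]_y (2 * eps * rwell y ^+ 2) =
  \int[T]_y ((eps * well y + 2 * bumps y) * rwell y ^+ 2).
Proof.
have e2 := elementary_rwell2.
have eW : elementary (fun y => (eps * well y + 2 * bumps y) * rwell y ^+ 2).
  apply: elementaryM => //; apply: elementaryD; apply: elementaryM;
    do ?exact: elementary_cst.
    exact: elementary_well.
  exact: elementary_bumps.
apply/eqP; rewrite -subr_eq0 -Rintegral_elementaryB//; last first.
  by apply: elementaryM => //; exact: elementary_cst.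
rewrite -[X in _ == X](Rintegral_laplacian (elementary_potential 1 0)); apply/eqP.
apply: eq_Rintegral => y _; rewrite laplacian_potential laplacian_lnE; ring.
Qed.

(** After [Rintegral_rwell2_eq] the integrand is at most [1/4 + 1/2] pointwise, because
    [4 * eps * well <= (well + eps)^2] and [4 * bumps <= well^2]. *)
Lemma Rintegral_rwell2_le : \int[T]_y (2 * eps * rwell y ^+ 2) <= 3 / 4.
Proof.
rewrite Rintegral_rwell2_eq -[leRHS](@Rintegral_torus_cst R d).
apply: le_Rintegral_elementary.
- apply: elementaryM; last exact: elementary_rwell2.
  apply: elementaryD; apply: elementaryM; do ?exact: elementary_cst.
    exact: elementary_well.
  exact: elementary_bumps.
- exact: elementary_cst.
move=> x; rewrite exprVn ler_pdivrMr ?exprn_gt0 ?welleps_gt0//.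
have := bumps_le x; have := sqr_ge0 (well x - eps); have := well_ge0 x.
have := sqr_ge0 (well x); nra.
Qed.

(** After [Rintegral_rwell2_eq] the integrand is at least [2 * bumps / 25], because
    [well + eps <= 5]. *)
Lemma Rintegral_rwell2_ge : eps <= 1 ->
  1 / 25 <= \int[T]_y (eps * rwell y ^+ 2).
Proof.
move=> eps1.
have e2 := elementary_rwell2.
suff : 2 / 25 <= \int[T]_y (2 * eps * rwell y ^+ 2).
  under eq_Rintegral do rewrite -mulrA.
  rewrite Rintegral_elementaryZ; first by lra.
  by apply: elementaryM => //; exact: elementary_cst.
rewrite Rintegral_rwell2_eq.
rewrite [leLHS](_ : _ = \int[T]_y (2 / 25 * bumps y)); last first.
  by rewrite Rintegral_elementaryZ ?Rintegral_bumps ?mulr1//; exact: elementary_bumps.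
apply: le_Rintegral_elementary.
- apply: elementaryM; first exact: elementary_cst.
  exact: elementary_bumps.
- apply: elementaryM => //.
  apply: elementaryD; apply: elementaryM; do ?exact: elementary_cst.
    exact: elementary_well.
  exact: elementary_bumps.
move=> x; rewrite exprVn ler_pdivlMr ?exprn_gt0 ?welleps_gt0//.
have u5 : (well x + eps) ^+ 2 <= 25.
  have u5 : well x + eps <= 5 by have := well_le4 x; lra.
  move: (well x + eps) u5 (welleps_gt0 x) => u u5 u0; nra.
have := bumps_ge0 x => b0.
have : bumps x * (well x + eps) ^+ 2 <= bumps x * 25 by rewrite ler_wpM2l.
have : 0 <= eps * well x by rewrite mulr_ge0 ?well_ge0// ltW.
by lra.
Qed.

End regularised.

(** With [u = well + eps], the difference of the two integrands is
    [eps / (u * (u + eps))], which is at least half of [eps / u^2]; the integral of the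
    latter is bounded below by [Rintegral_rwell2_ge]. *)
Lemma Rintegral_rwell_double eps : 0 < eps -> eps <= 1 ->
  \int[T]_y rwell (2 * eps) y + 1 / 50 <= \int[T]_y rwell eps y.
Proof.
move=> e0 e1.
have e20 : 0 < 2 * eps by rewrite mulr_gt0.
have er := elementary_rwell e0; have er2 := elementary_rwell e20.
have eM : elementary (fun y => eps * rwell eps y ^+ 2).
  by apply: elementaryM; [exact: elementary_cst|exact: elementary_rwell2].
have eM2 : elementary (fun y => 1 / 2 * (eps * rwell eps y ^+ 2)).
  by apply: elementaryM => //; exact: elementary_cst.
apply: (@le_trans _ _ (\int[T]_y (rwell (2 * eps) y +
    1 / 2 * (eps * rwell eps y ^+ 2)))).
  rewrite Rintegral_elementaryD// Rintegral_elementaryZ//.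
  have := Rintegral_rwell2_ge e0 e1; lra.
apply: le_Rintegral_elementary => //; first exact: elementaryD.
move=> x; rewrite /rwell.
have w0 := well_ge0 x.
set u := well x + eps.
have u0 : 0 < u by exact: welleps_gt0.
have v0 : 0 < well x + 2 * eps by rewrite ltr_wpDl// mulr_gt0.
rewrite -subr_ge0.
rewrite (_ : _ - _ = eps * (well x / 2) / (u ^+ 2 * (well x + 2 * eps))).
  by rewrite divr_ge0// ?mulr_ge0// ?divr_ge0// ?sqr_ge0// ltW.
by rewrite /u; field; rewrite !gt_eqF.
Qed.

Lemma Rintegral_rwell_ge n :
  n%:R / 50 <= \int[T]_y rwell (2 ^- n) y.
Proof.
elim: n => [|n ih].
  rewrite mul0r; apply: Rintegral_ge0 => x _; apply: ltW; exact: rwell_gt0.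
have e0 : 0 < 2 ^- n.+1 :> R by rewrite invr_gt0 exprn_gt0.
have e1 : 2 ^- n.+1 <= 1 :> R by rewrite invf_le1 ?exprn_gt0// exprn_ege1// ler1n.
have := Rintegral_rwell_double e0 e1.
rewrite exprS invfM mulVKf ?pnatr_eq0// -natr1 => ?; lra.
Qed.

(** The term in [B] only adds to the length of the gradient. The energy of the
    logarithm itself is the integral of [slope2 * rwell^2], and since the Laplacian of
    the logarithm has integral 0, that of [(2 - well) * rwell]. *)
Lemma sq_gradient_potential_ge A B eps : 0 < eps -> 0 <= A -> 0 <= B ->
  (2 * pi) ^- 2 * (A ^+ 2 * (2 * \int[T]_y rwell eps y - 1)) <=
  \int[T]_y sq_gradient (potential eps A B) y.
Proof.
move=> e0 A0 B0.
have er := elementary_rwell e0; have er2 := elementary_rwell2 e0.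
have es := elementary_slope2.
have esr : elementary (fun y => slope2 y * rwell eps y ^+ 2) by exact: elementaryM.
have eAsr : elementary (fun y => A ^+ 2 * (slope2 y * rwell eps y ^+ 2)).
  by apply: elementaryM => //; exact: elementary_cst.
have pi2 : 0 <= (2 * pi) ^- 2 :> R by rewrite invr_ge0 sqr_ge0.
apply: (@le_trans _ _ (\int[T]_y ((2 * pi) ^- 2 *
    (A ^+ 2 * (slope2 y * rwell eps y ^+ 2))))); last first.
  apply: le_Rintegral_elementary.
  - by apply: elementaryM => //; exact: elementary_cst.
  - exact/elementary_sq_gradient/elementary_potential.
  move=> x; rewrite sq_gradient_potential// ler_wpM2l//.
  rewrite mulrCA mulrC ler_wpM2r// ?slope2_ge0//.
  rewrite -exprMn ler_sqr ?nnegrE; last 2 first.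
  - by rewrite mulr_ge0// ltW// rwell_gt0.
  - by rewrite addr_ge0// mulr_ge0// ltW// rwell_gt0.
  by rewrite lerDl.
rewrite !Rintegral_elementaryZ// !ler_wpM2l// ?sqr_ge0//.
have := Rintegral_laplacian (elementary_potential e0 1 0).
have ewr : elementary (fun y => (2 - well y) * rwell eps y).
  apply: elementaryM => //; apply: elementaryD; first exact: elementary_cst.
  exact/elementaryN/elementary_well.
rewrite (_ : laplacian _ = fun y => (2 - well y) * rwell eps y -
    slope2 y * rwell eps y ^+ 2); last first.
  by apply/funext => y; rewrite laplacian_potential// mul1r mul0r addr0.
rewrite Rintegral_elementaryB// => /eqP; rewrite subr_eq0 => /eqP <-.
have e2r : elementary (fun y => 2 * rwell eps y).
  by apply: elementaryM => //; exact: elementary_cst.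
rewrite -Rintegral_elementaryZ// -[X in _ - X](@Rintegral_torus_cst R d).
rewrite -Rintegral_elementaryB//; last exact: elementary_cst.
apply: le_Rintegral_elementary => //.
  by apply: elementaryD => //; exact: elementary_cst.
move=> x; have e := rwellK e0 x.
have : 0 <= eps * rwell eps x by rewrite mulr_ge0 ?ltW// rwell_gt0.
by rewrite mulrDr in e; rewrite mulrBl; lra.
Qed.

End log_potential.

(** * The counterexample *)

Section counterexample.
Variables (R : realType) (d : nat) (i0 i1 : 'I_d).
Hypothesis i01 : i0 != i1.
Variables lambda A B r : R.
Hypotheses (lambda_gt0 : 0 < lambda) (A_gt0 : 0 < A) (B_gt0 : 0 < B).
Hypotheses (r_gt0 : 0 < r) (r_lt2 : r < 2).
(* The two requirements on the constants: the Laplacian stays above [lambda] on the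
   core, where the logarithm takes away at most [A / 2], and the mass of
   [max (laplacian phi) lambda] does not exceed 1, the approximate Dirac mass
   contributing at most [A * (3 / 4)]. *)
Hypothesis core : lambda <= B * (2 - r) - A / 2.
Hypothesis mass : 2 * B + A * (3 / 4) <= 1.
Local Notation T := (torus_measure R d).
Local Notation s := (@well R d i0 i1).
Local Notation phi eps := (potential i0 i1 eps A B).

Lemma le_laplacian_core (eps : R) x : 0 < eps -> s x <= r ->
  lambda <= laplacian (phi eps) x.
Proof.
move=> e0 sr; rewrite laplacian_potential// laplacian_lnE//.
have u0 : 0 < s x + eps by exact: welleps_gt0.
have s0 : 0 <= s x by exact: well_ge0.
have b0 := bumps_le i0 i1 x.
have k : - (1 / 2) <= (2 * eps - eps * s x - 2 * bumps i0 i1 x)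
    * rwell i0 i1 eps x ^+ 2.
  rewrite exprVn ler_pdivlMr ?exprn_gt0//.
  have : 0 <= eps * (2 - s x).
    by rewrite mulr_ge0 ?subr_ge0 ?(ltW e0)// (le_trans sr)// ltW.
  have : 0 <= eps * s x by rewrite mulr_ge0// ltW.
  have := sqr_ge0 eps; move: b0; lra.
have : A * - (1 / 2) <= A * ((2 * eps - eps * s x - 2 * bumps i0 i1 x)
    * rwell i0 i1 eps x ^+ 2) by rewrite ler_wpM2l// ltW.
have : B * (2 - r) <= B * (2 - s x) by rewrite ler_wpM2l ?lerB// ltW.
move: core; lra.
Qed.

Lemma Rintegral_max_le (eps : R) : 0 < eps ->
  \int[T]_y Num.max (laplacian (phi eps) y) lambda <= 1.
Proof.
move=> e0.
have eL : elementary (laplacian (phi eps)).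
  exact/elementary_laplacian/elementary_potential.
have er2 : elementary (fun y : 'rV[R]_d => 2 * eps * rwell i0 i1 eps y ^+ 2).
  by apply: elementaryM; [exact: elementary_cst|exact: elementary_rwell2].
have eAr2 : elementary (fun y : 'rV[R]_d =>
    A * (2 * eps * rwell i0 i1 eps y ^+ 2)).
  by apply: elementaryM => //; exact: elementary_cst.
have e2B : @elementary R d (fun=> 2 * B) by exact: elementary_cst.
(* A majorant of both the Laplacian and [lambda]. *)
pose U (y : 'rV[R]_d) := 2 * B + A * (2 * eps * rwell i0 i1 eps y ^+ 2).
have LU y : laplacian (phi eps) y <= U y.
  rewrite laplacian_potential// laplacian_lnE// /U addrC lerD//.
    rewrite mulrC ler_wpM2r ?(ltW B_gt0)//.
    by rewrite lerBlDr lerDl well_ge0.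
  rewrite ler_wpM2l ?(ltW A_gt0)// ler_wpM2r ?sqr_ge0//.
  have : 0 <= eps * s y by rewrite mulr_ge0 ?well_ge0 ?ltW.
  have := bumps_ge0 i0 i1 y; lra.
have lU y : lambda <= U y.
  apply: (@le_trans _ _ (2 * B)).
    have : 0 <= B * r by rewrite mulr_ge0// ltW.
    by move: core A_gt0; lra.
  have e20 : 0 <= 2 * eps by rewrite mulr_ge0// ltW.
  by rewrite /U lerDl (mulr_ge0 (ltW A_gt0))// (mulr_ge0 e20)// sqr_ge0.
have eU : elementary U by exact: elementaryD.
have U1 : \int[T]_y U y <= 1.
  rewrite Rintegral_elementaryD// Rintegral_torus_cst Rintegral_elementaryZ//.
  apply: le_trans mass; rewrite lerD2l ler_wpM2l ?(ltW A_gt0)//.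
  exact: Rintegral_rwell2_le.
apply: le_trans U1; apply: le_Rintegral => //.
- apply: integrable_bounded.
    apply: (@measurable_maxr _ _ _ _ (laplacian (phi eps)) (cst lambda)) => //.
    exact: elementary_measurable.
  have [C LC] := elementary_bounded eL; exists (C + lambda) => y.
  have := LC y; rewrite ler_norml => /andP[_ LyC].
  have C0 := le_trans (normr_ge0 _) (LC y).
  rewrite ger0_norm; last by rewrite le_max (ltW lambda_gt0) orbT.
  by rewrite ge_max; apply/andP; split; move: lambda_gt0; lra.
- exact: elementary_integrable.
- by move=> y _; rewrite ge_max LU lU.
Qed.

(** The missing mass is placed outside the core, by means of the positive part of
    [well - r]; thus the source vanishes on the core, and elsewhere the factor [1 / u]
    in the gradient is at most [1 / r]. *)
Lemma large_MMD_bounded_dissipation (g : 'rV[R]_d -> R)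
    (G : 'I_d -> 'rV[R]_d -> R) (eps : R) :
  coulomb_kernel g -> weak_gradient g G -> 0 < eps ->
  exists mu rho, [/\ prob_density mu, forall x, lambda <= mu x, prob_density rho,
    ((2^-1 * ((2 * pi) ^- 2 *
        (A ^+ 2 * (2 * \int[T]_y rwell i0 i1 eps y - 1))))%:E <=
      MMD2 g rho mu)%E &
    (dissipation G rho mu <= ((2 * pi) ^- 2 * ((A / r + B) ^+ 2 * 2))%:E)%E].
Proof.
move=> gC gG e0.
have ephi : elementary (phi eps) by exact: elementary_potential.
have es := elementary_well R i0 i1.
pose w (y : 'rV[R]_d) := Num.max (s y - r) 0.
have esr : elementary (fun y => s y - r).
  by apply: elementaryD => //; exact: elementary_cst.
have mw : measurable_fun setT w.
  apply: (@measurable_maxr _ _ _ _ (fun y => s y - r) (cst 0)) => //.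
  exact: elementary_measurable.
have w0 y : 0 <= w y by rewrite /w le_max lexx orbT.
have bw : unif_bounded w.
  exists 4 => y; rewrite ger0_norm// ge_max ler0n andbT.
  by rewrite lerBlDr ler_wpDr ?well_le4// ltW.
have wp : Defs.periodic w by move=> i y; rewrite /w (elementary_periodic es).
have intw : 0 < \int[T]_y w y.
  apply: (@lt_le_trans _ _ (2 - r)); first by rewrite subr_gt0.
  rewrite -(Rintegral_well i01 e0) -[X in _ - X](@Rintegral_torus_cst R d).
  rewrite -Rintegral_elementaryB//; last exact: elementary_cst.
  apply: le_Rintegral => //; first exact: elementary_integrable.
    exact: integrable_bounded.
  by move=> y _; rewrite /w le_max lexx.
have [mu [rho [pmu lmu prho rm rho0]]] := densities_of_laplacian ephi wp mw bw w0
  intw (ltW lambda_gt0) (Rintegral_max_le e0).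
exists mu, rho; split => //.
  rewrite (MMD2_laplacian gC ephi rm) lee_fin ler_wpM2l// ?invr_ge0//.
  by apply: sq_gradient_potential_ge => //; exact: ltW.
apply: (dissipation_laplacian_le gC gG ephi rm prho) => x rhox.
have sr : r < s x.
  rewrite ltNge; apply/negP => sr; case/negP: rhox; apply/eqP; apply: rho0.
    exact: le_laplacian_core.
  by apply/max_idPr; rewrite subr_le0.
rewrite sq_gradient_potential// ler_wpM2l ?invr_ge0 ?sqr_ge0//.
have rw0 := rwell_gt0 i0 i1 e0 x.
apply: ler_pM; rewrite ?sqr_ge0 ?slope2_ge0 ?slope2_le2//.
rewrite ler_sqr ?nnegrE; last 2 first.
- by rewrite addr_ge0 ?mulr_ge0// ltW.
- by rewrite addr_ge0 ?divr_ge0// ltW.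
rewrite lerD2r (ler_wpM2l (ltW A_gt0))// /rwell lef_pV2 ?posrE ?welleps_gt0//.
by rewrite (le_trans (ltW sr))// lerDl ltW.
Qed.

End counterexample.

Theorem proposition1p11 (R : realType) (d : nat) (lambda : R)
    (d_ge2 : (2 <= d)%N) (lambda_gt0 : 0 < lambda) (lambda_lt1 : lambda < 1)
    (g : 'rV[R]_d -> R) (G : 'I_d -> 'rV[R]_d -> R)
    (g_coulomb : coulomb_kernel g) (G_grad : weak_gradient g G) :
  ~ exists2 c : R, 0 < c &
      forall mu rho : 'rV[R]_d -> R,
        prob_density mu ->
        {ae torus_measure R d, forall x, lambda <= mu x} ->
        prob_density rho ->
        (c%:E * MMD2 g rho mu <= dissipation G rho mu)%E.
Proof.
move=> [c c0 cP].
pose i0 : 'I_d := Ordinal (ltnW d_ge2); pose i1 : 'I_d := Ordinal d_ge2.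
have i01 : i0 != i1 by [].
(* [2 * B] lies halfway between [lambda] and 1; [A] and [r] only need to be small
   compared with the gap. *)
pose A : R := (1 - lambda) / 2; pose B : R := (1 + lambda) / 4.
have A_gt0 : 0 < A by rewrite divr_gt0// subr_gt0.
have B_gt0 : 0 < B by rewrite divr_gt0// addr_gt0.
have A_lt2 : A < 2 by rewrite /A; move: lambda_gt0; lra.
have core : lambda <= B * (2 - A) - A / 2.
  have : 0 <= (1 - lambda) ^+ 2 by exact: sqr_ge0.
  by rewrite /A /B; move: lambda_lt1; lra.
have mass : 2 * B + A * (3 / 4) <= 1 by rewrite /A /B; move: lambda_lt1; lra.
pose k := c * (2^-1 * ((2 * pi) ^- 2 * A ^+ 2)).
have k0 : 0 < k.
  have pi2 : 0 < 2 * pi :> R by rewrite mulr_gt0 ?pi_gt0.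
  rewrite (mulr_gt0 c0)// mulr_gt0 ?invr_gt0//.
  by rewrite mulr_gt0 ?invr_gt0 ?exprn_gt0.
pose C : R := (2 * pi) ^- 2 * ((A / A + B) ^+ 2 * 2).
have bound n : k * (2 * (n%:R / 50) - 1) <= C.
  have e0 : 0 < 2 ^- n :> R by rewrite invr_gt0 exprn_gt0.
  have [mu [rho [pmu lmu prho MMDge Dle]]] := large_MMD_bounded_dissipation i01
    lambda_gt0 A_gt0 B_gt0 A_gt0 A_lt2 core mass g_coulomb G_grad e0.
  rewrite -lee_fin; apply: le_trans Dle.
  apply: le_trans (cP mu rho pmu (aeW _ lmu) prho).
  apply: le_trans (lee_wpmul2l _ MMDge); last by rewrite lee_fin ltW.
  rewrite -EFinM lee_fin [leLHS](_ : _ = c * (2^-1 * ((2 * pi) ^- 2 *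
    (A ^+ 2 * (2 * (n%:R / 50) - 1))))); last by rewrite /k !mulrA.
  rewrite (ler_wpM2l (ltW c0))// ler_wpM2l ?invr_ge0// ler_wpM2l ?invr_ge0 ?sqr_ge0//.
  rewrite ler_wpM2l ?sqr_ge0//.
  by rewrite lerB// ler_wpM2l// Rintegral_rwell_ge.
pose n := Num.bound `|25 * (C / k + 1)|.
have nP : 25 * (C / k + 1) < n%:R.
  exact: le_lt_trans (ler_norm _) (archi_boundP (normr_ge0 _)).
have : C < k * (2 * (n%:R / 50) - 1).
  by rewrite -ltr_pdivrMl// mulrC; move: nP; lra.
by rewrite ltNge bound.
Qed.
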